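(* Let $I\subseteq\mathbb R$ be an open interval, let $\mathbf A:I\to\mathbb H^{n\times n}$ be continuous, and let $\{\mathbf x_1,\dots,\mathbf x_n\}$ be a right linearly independent set of solutions on $I$ of the homogeneous right system $\mathbf x'=\mathbf A(t)\mathbf x$. Then for every solution $\mathbf x$ of this system on $I$ there exist constant quaternions $q_1,\dots,q_n\in\mathbb H$ such that $$\mathbf x(t)=\mathbf x_1(t)q_1+\dots+\mathbf x_n(t)q_n\qquad(t\in I).$$
   Context: $\mathbb H$ is the real quaternion skew field. Solutions of $\mathbf x'=\mathbf A(t)\mathbf x$ are differentiable column-vector functions $\mathbf x:I\to\mathbb H^{n\times1}$ of the real variable $t$; derivatives are componentwise. A set of column-vector functions $\{\mathbf x_1,\dots,\mathbf x_n\}$ is right linearly dependent on $I$ if there exist constants $q_1,\dots,q_n\in\mathbb H$, not all zero, such that $\mathbf x_1(t)q_1+\dots+\mathbf x_n(t)q_n=\mathbf 0$ for all $t\in I$; it is right linearly independent otherwise. *)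

(* Defs.v *)
From HB Require Import structures.
From mathcomp Require Import all_boot all_order all_algebra ring lra.
From mathcomp Require Import all_classical all_reals all_analysis.
Set Implicit Arguments.
Unset Strict Implicit.
Unset Printing Implicit Defensive.
Import Order.TTheory GRing.Theory Num.Theory numFieldNormedType.Exports.
Local Open Scope classical_set_scope.
Local Open Scope ring_scope.

(* The coordinates of a quaternion are taken along 1, i, j, k.  The topology
   and the real normed-space structure are those of R^4; the norm `|q| is the
   max norm of the coordinates, not the usual quaternion modulus (both norms
   define the same limits and derivatives). *)
Definition quat (R : realType) : Type := 'rV[R]_4.

HB.instance Definition _ (R : realType) :=
  NormedModule.copy (quat R) 'rV[R]_4.
HB.instance Definition _ (R : realType) :=
  Complete.copy (quat R) 'rV[R]_4.

Section QuatRing.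
Variable R : realType.
Implicit Types p q r : quat R.

Definition mkquat (a b c d : R) : quat R := \row_(k < 4) [:: a; b; c; d]`_k.

Definition qre q : R := q ord0 (inord 0).
Definition qi q : R := q ord0 (inord 1).
Definition qj q : R := q ord0 (inord 2).
Definition qk q : R := q ord0 (inord 3).

Lemma quatP p q :
  [/\ qre p = qre q, qi p = qi q, qj p = qj q & qk p = qk q] -> p = q.
Proof.
case=> h0 h1 h2 h3; apply/rowP => -[[|[|[|[|//]]]] hk].
- by rewrite (_ : Ordinal hk = inord 0) //; apply/val_inj; rewrite /= inordK.
- by rewrite (_ : Ordinal hk = inord 1) //; apply/val_inj; rewrite /= inordK.
- by rewrite (_ : Ordinal hk = inord 2) //; apply/val_inj; rewrite /= inordK.
- by rewrite (_ : Ordinal hk = inord 3) //; apply/val_inj; rewrite /= inordK.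
Qed.

Lemma qre_mk a b c d : qre (mkquat a b c d) = a.
Proof. by rewrite /qre mxE inordK. Qed.
Lemma qi_mk a b c d : qi (mkquat a b c d) = b.
Proof. by rewrite /qi mxE inordK. Qed.
Lemma qj_mk a b c d : qj (mkquat a b c d) = c.
Proof. by rewrite /qj mxE inordK. Qed.
Lemma qk_mk a b c d : qk (mkquat a b c d) = d.
Proof. by rewrite /qk mxE inordK. Qed.
Definition quat_mkE := (qre_mk, qi_mk, qj_mk, qk_mk).

Lemma qreD p q : qre (p + q) = qre p + qre q. Proof. exact: mxE. Qed.
Lemma qiD p q : qi (p + q) = qi p + qi q. Proof. exact: mxE. Qed.
Lemma qjD p q : qj (p + q) = qj p + qj q. Proof. exact: mxE. Qed.
Lemma qkD p q : qk (p + q) = qk p + qk q. Proof. exact: mxE. Qed.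
Definition quat_addE := (qreD, qiD, qjD, qkD).

Lemma qre0 : qre 0 = 0. Proof. exact: mxE. Qed.
Lemma qi0 : qi 0 = 0. Proof. exact: mxE. Qed.
Lemma qj0 : qj 0 = 0. Proof. exact: mxE. Qed.
Lemma qk0 : qk 0 = 0. Proof. exact: mxE. Qed.
Definition quat0E := (qre0, qi0, qj0, qk0).

Definition quat1 : quat R := mkquat 1 0 0 0.

(* Hamilton product: i^2 = j^2 = k^2 = ijk = -1. *)
Definition mulq p q : quat R :=
  mkquat
    (qre p * qre q - qi p * qi q - qj p * qj q - qk p * qk q)
    (qre p * qi q + qi p * qre q + qj p * qk q - qk p * qj q)
    (qre p * qj q - qi p * qk q + qj p * qre q + qk p * qi q)
    (qre p * qk q + qi p * qj q - qj p * qi q + qk p * qre q).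

Lemma mulqA : associative mulq.
Proof. by move=> p q r; apply: quatP; rewrite !quat_mkE; split; ring. Qed.
Lemma mul1q : left_id quat1 mulq.
Proof. by move=> p; apply: quatP; rewrite !quat_mkE; split; ring. Qed.
Lemma mulq1 : right_id quat1 mulq.
Proof. by move=> p; apply: quatP; rewrite !quat_mkE; split; ring. Qed.
Lemma mulqDl : left_distributive mulq +%R.
Proof.
by move=> p q r; apply: quatP; rewrite !(quat_addE, quat_mkE); split; ring.
Qed.
Lemma mulqDr : right_distributive mulq +%R.
Proof.
by move=> p q r; apply: quatP; rewrite !(quat_addE, quat_mkE); split; ring.
Qed.
Lemma quat1_neq0 : quat1 != 0.
Proof.
by apply/eqP => /(congr1 qre); rewrite qre_mk qre0 => /eqP; rewrite oner_eq0.
Qed.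

HB.instance Definition _ := GRing.Zmodule_isNzRing.Build (quat R)
  mulqA mul1q mulq1 mulqDl mulqDr quat1_neq0.

Definition qnormsq q : R := qre q ^+ 2 + qi q ^+ 2 + qj q ^+ 2 + qk q ^+ 2.

Definition invq q : quat R :=
  mkquat (qre q / qnormsq q) (- qi q / qnormsq q)
         (- qj q / qnormsq q) (- qk q / qnormsq q).

Lemma qnormsq_eq0 q : (qnormsq q == 0) = (q == 0).
Proof.
apply/eqP/eqP => [|->]; last by rewrite /qnormsq !quat0E; ring.
move=> h; have h' : (qre q ^+ 2 = 0) /\ (qi q ^+ 2 = 0)
  /\ (qj q ^+ 2 = 0) /\ (qk q ^+ 2 = 0).
  move: h (sqr_ge0 (qre q)) (sqr_ge0 (qi q)) (sqr_ge0 (qj q)) (sqr_ge0 (qk q)).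
  by rewrite /qnormsq; do 4?[split]; lra.
case: h' => /eqP + [/eqP + [/eqP + /eqP]]; rewrite !sqrf_eq0.
by do 4![move=> /eqP ?]; apply: quatP; rewrite !quat0E.
Qed.

Lemma mulVq q : q != 0 -> invq q * q = 1.
Proof.
rewrite -qnormsq_eq0 /qnormsq => q0.
by apply: quatP; rewrite !quat_mkE /qnormsq; split; field.
Qed.

Lemma mulqV q : q != 0 -> q * invq q = 1.
Proof.
rewrite -qnormsq_eq0 /qnormsq => q0.
by apply: quatP; rewrite !quat_mkE /qnormsq; split; field.
Qed.

Lemma invq0 q : ~~ (q != 0) -> invq q = q.
Proof.
rewrite negbK => /eqP ->; apply: quatP.
by rewrite !quat_mkE !quat0E; split; ring.
Qed.

Lemma unitq p q : q * p = 1 /\ p * q = 1 -> p != 0.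
Proof.
by case=> + _; apply: contra_eq_neq => ->; rewrite mulr0 eq_sym oner_eq0.
Qed.

HB.instance Definition _ := GRing.NzRing_hasMulInverse.Build (quat R)
  mulVq mulqV unitq invq0.

End QuatRing.

Section RightSystem.
Variables (R : realType) (n : nat).

(* x' = A(t) x on I; only the values of A on I matter. *)
Definition right_solution (I : set R) (A : R -> 'M[quat R]_n)
    (x : R -> 'cV[quat R]_n) : Prop :=
  forall t, I t -> forall i : 'I_n,
    is_derive t 1 (fun s => x s i ord0) ((A t *m x t) i ord0).

Definition rscale (x : 'cV[quat R]_n) (q : quat R) : 'cV[quat R]_n :=
  map_mx (fun a => a * q) x.

Definition right_dependent (I : set R) (m : nat)
    (x : 'I_m -> R -> 'cV[quat R]_n) : Prop :=
  exists q : 'I_m -> quat R, (exists k, q k <> 0) /\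
    forall t, I t -> \sum_(k < m) rscale (x k t) (q k) = 0.

Definition right_independent (I : set R) (m : nat)
    (x : 'I_m -> R -> 'cV[quat R]_n) : Prop :=
  ~ right_dependent I x.

End RightSystem.

(* Main.v *)
Require Import Defs.
From mathcomp Require Import all_boot all_order all_algebra.
From mathcomp Require Import all_classical all_reals all_analysis.
From HB Require Import structures.
From mathcomp Require Import ring lra.
Import numFieldNormedType.Exports.
Import Order.TTheory GRing.Theory Num.Theory.
Local Open Scope classical_set_scope.
Local Open Scope ring_scope.

Set Implicit Arguments.
Unset Strict Implicit.
Unset Printing Implicit Defensive.

(** The difference of two solutions is a solution, and a solution times a
    constant quaternion on the right is a solution: A acts on the left, so the
    two multiplications commute by associativity.  The theorem therefore
    reduces to linear algebra at one point and a uniqueness statement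
    ([right_solution_eq0]): a solution that vanishes at one point t0 of the
    interval vanishes on all of it.

    Uniqueness is an energy estimate.  Let N(t) be the sum of the squares of
    the 4n real coordinates of x(t).  Multiplicativity of the quaternion norm
    gives |N'| <= (n + |A(t)|^2) N ([qdot_mulmx_le]), where |A(t)|^2 is the sum
    of the squared norms of the entries.  On a compact segment this factor is
    bounded by a constant K because A is continuous, so exp(-Kt) N(t) decreases
    and exp(Kt) N(t) increases ([gronwall_zero]); as N >= 0 and N(t0) = 0, both
    facts together force N = 0 on either side of t0.

    Fix t0.  By uniqueness, a relation between the x_k(t0) with constant right
    coefficients holds at every t, so independence of the functions makes the
    n vectors x_k(t0) right independent.  They then span H^n
    ([right_free_spans]): the map (q_k) |-> sum_k x_k(t0) q_k is an injective
    R-linear endomorphism of a real space of dimension 4n, hence onto; viewing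
    it over R avoids linear algebra over a skew field.  Choose q with
    x(t0) = sum_k x_k(t0) q_k.  The solution x - sum_k x_k q_k vanishes at t0,
    hence everywhere. *)

(** * Quaternion vectors as a real vector space *)

Lemma quat_scaleE (R : realType) (a : R) (p : quat R) :
  [/\ qre (a *: p) = a * qre p, qi (a *: p) = a * qi p,
      qj (a *: p) = a * qj p & qk (a *: p) = a * qk p].
Proof. by split; exact: mxE. Qed.

Lemma mulq_linearl (R : realType) (q : quat R) :
  linear (fun p : quat R => p * q).
Proof.
move=> a p p'; rewrite mulrDl; congr (_ + _).
apply: quatP; have [-> -> -> ->] := quat_scaleE a (p * q).
have [e0 e1 e2 e3] := quat_scaleE a p.
by rewrite !quat_mkE e0 e1 e2 e3; split; ring.
Qed.

Lemma mulq_linearr (R : realType) (p : quat R) :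
  linear (fun q : quat R => p * q).
Proof.
move=> a q q'; rewrite mulrDr; congr (_ + _).
apply: quatP; have [-> -> -> ->] := quat_scaleE a (p * q).
have [e0 e1 e2 e3] := quat_scaleE a q.
by rewrite !quat_mkE e0 e1 e2 e3; split; ring.
Qed.

Section RightCombination.
Context (R : realType) (n : nat).
Implicit Types (X : 'I_n -> 'cV[quat R]_n) (q : 'I_n -> quat R).

(** Families of n quaternions are encoded as real n x 4 matrices, one quaternion
    per row, so that real rank-nullity applies to the map sending a family of
    coefficients to the combination of the X k. *)
Lemma right_free_spans X :
  (forall q, \sum_(k < n) rscale (X k) (q k) = 0 -> forall k, q k = 0) ->
  forall v, exists q, v = \sum_(k < n) rscale (X k) (q k).
Proof.
move=> Xfree v.
pose Phi (Q : 'M[R]_(n, 4)) : 'M[R]_(n, 4) :=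
  \matrix_(i < n) (\sum_(k < n) X k i ord0 * (row k Q : quat R) : quat R).
have PhiE Q i : (row i (Phi Q) : quat R) =
    (\sum_(k < n) rscale (X k) (row k Q : quat R)) i ord0.
  by rewrite rowK summxE; apply: eq_bigr => k _; rewrite mxE.
have lin_Phi : linear Phi.
  move=> a P Q; apply/row_matrixP => i.
  rewrite linearP /= !rowK (scaler_sumr a) -big_split /=.
  by apply: eq_bigr => k _; rewrite linearP mulq_linearr.
pose Phi_lin := GRing.isLinear.Build _ _ _ _ _ lin_Phi.
pose PhiL : {linear 'M[R]_(n, 4) -> 'M[R]_(n, 4)} := HB.pack Phi Phi_lin.
have ker0 : lker (linfun PhiL) == 0%VS.
  apply/lker0P => P Q; rewrite !lfunE /= => ePQ; apply/eqP; rewrite -subr_eq0.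
  apply/eqP/row_matrixP => k; rewrite row0.
  apply: (Xfree (fun k => row k (P - Q))); apply/matrixP => i j.
  rewrite ord1 -PhiE.
  by have /= := linearB PhiL P Q; rewrite /= ePQ subrr => ->; rewrite row0 mxE.
pose V : 'M[R]_(n, 4) := \matrix_(i < n) (v i ord0 : 'rV[R]_4).
exists (fun k => row k ((linfun PhiL)^-1%VF V)).
apply/matrixP => i j; rewrite ord1 -PhiE.
by have := lker0_lfunVK ker0 V; rewrite lfunE /= => ->; rewrite rowK.
Qed.

End RightCombination.

(** * Derivatives and a Gronwall estimate *)

Section Derivative.
Context (R : realType).

Lemma is_derive_rowP m (f : R -> 'rV[R]_m) (t : R) (df : 'rV[R]_m) :
  is_derive t 1 f df <->
  forall c, is_derive t 1 (fun s => f s ord0 c) (df ord0 c).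
Proof.
split=> [[fD <-] c|fD].
  split; first exact: (derivable_mxP _ _ _).1 fD _ _.
  by rewrite derive_mx // mxE.
have fd : derivable f t 1.
  by apply/derivable_mxP => i c; rewrite ord1; case: (fD c).
split=> //; apply/rowP => c; rewrite derive_mx // mxE.
by case: (fD c).
Qed.

(** In finite dimension every linear map is given by a real matrix, so it
    commutes with differentiation coordinate by coordinate. *)
Lemma is_derive_linear m p (L : 'rV[R]_m -> 'rV[R]_p) (f : R -> 'rV[R]_m)
    (t : R) (df : 'rV[R]_m) :
  linear L -> is_derive t 1 f df -> is_derive t 1 (L \o f) (L df).
Proof.
move=> linL /is_derive_rowP fD.
pose Lm := GRing.isLinear.Build _ _ _ _ _ linL.
pose LL : {linear 'rV[R]_m -> 'rV[R]_p} := HB.pack L Lm.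
have LE u c : L u ord0 c = \sum_d lin1_mx LL d c *: u ord0 d.
  have := mul_rV_lin1 LL u => /= /(congr1 (fun w : 'rV_p => w ord0 c)) <-.
  by rewrite mxE; apply: eq_bigr => d _; rewrite mulrC.
apply/is_derive_rowP => c.
rewrite LE (_ : (fun s => _) =
    \sum_d (lin1_mx LL d c \*: (fun s => f s ord0 d))); last first.
  by apply/funext => s /=; rewrite LE fct_sumE.
by apply: is_derive_sum => d; apply: is_deriveZ; exact: fD.
Qed.

(** The bound on |E'| says that E(s) exp(- K s) decreases and E(s) exp(K s)
    increases; the former carries the value 0 of E forwards, the latter carries
    it backwards. *)
Lemma gronwall_zero (E dE : R -> R) (a b K : R) :
  (forall s, s \in `[a, b] -> is_derive s 1 E (dE s)) ->
  (forall s, s \in `[a, b] -> `|dE s| <= K * E s) ->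
  a <= b -> (E a = 0 -> E b <= 0) /\ (E b = 0 -> E a <= 0).
Proof.
move=> ED dEle ab.
have FD k s : s \in `[a, b] -> is_derive s 1 (fun r => E r * expR (k * r))
    ((dE s + k * E s) * expR (k * s)).
  move=> /ED ?.
  rewrite (_ : (fun r => _) = E * (expR \o (k \*: id))); last by apply/funext.
  by apply: is_derive_eq; rewrite /GRing.scale /=; ring.
have Fc k : {within `[a, b], continuous (fun r => E r * expR (k * r))}.
  apply: continuous_in_subspaceT => s /set_mem sab.
  apply: differentiable_continuous; apply/derivable1_diffP.
  by case: (FD k s sab).
have oc s : s \in `]a, b[ -> s \in `[a, b] by exact: subset_itv_oo_cc.
have [aI bI] : a \in `[a, b] /\ b \in `[a, b] by rewrite !in_itv /= !lexx ab.
split=> E0.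
- have : E b * expR (- K * b) <= E a * expR (- K * a).
    apply: (ler0_derive1_nincr _ _ (Fc (- K)) (lexx a) ab (lexx b)).
      by move=> s /oc sab; case: (FD (- K) s sab).
    move=> s /oc sab; rewrite derive1E; case: (FD (- K) s sab) => _ ->.
    rewrite pmulr_lle0 ?expR_gt0 // mulNr subr_le0.
    exact: le_trans (ler_norm _) (dEle s sab).
  by rewrite E0 mul0r pmulr_lle0 ?expR_gt0.
- have : E a * expR (K * a) <= E b * expR (K * b).
    apply: (ger0_derive1_ndecr _ _ (Fc K) (lexx a) ab (lexx b)).
      by move=> s /oc sab; case: (FD K s sab).
    move=> s /oc sab; rewrite derive1E; case: (FD K s sab) => _ ->.
    rewrite pmulr_lge0 ?expR_gt0 // -lerBlDr sub0r.
    by have := dEle s sab; rewrite ler_norml => /andP[].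
  by rewrite E0 mul0r pmulr_lle0 ?expR_gt0.
Qed.

End Derivative.

(** * Norm estimates for left multiplication by a matrix *)

Section SquaredNorm.
Context (R : realType).
Implicit Types p q : quat R.

Definition qdot p q : R := \sum_c p ord0 c * q ord0 c.

Lemma qnormsq_qdot p : qnormsq p = qdot p p.
Proof.
rewrite /qdot 4!big_ord_recl big_ord0 addr0 /qnormsq /qre /qi /qj /qk -!expr2.
by rewrite !addrA; do 3?congr (_ + _); do 2 f_equal;
  apply/val_inj; rewrite /= inordK.
Qed.

Lemma qnormsqM p q : qnormsq (p * q) = qnormsq p * qnormsq q.
Proof. by rewrite /qnormsq !quat_mkE; ring. Qed.

Lemma qnormsq_ge0 q : 0 <= qnormsq q.
Proof. by rewrite /qnormsq !addr_ge0 ?sqr_ge0. Qed.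

Lemma qdot_sumr p m (F : 'I_m -> quat R) :
  qdot p (\sum_j F j) = \sum_j qdot p (F j).
Proof.
rewrite exchange_big; apply: eq_bigr => c _ /=.
by rewrite -mulr_sumr; congr (_ * _); rewrite summxE.
Qed.

Lemma qdot_young p q : 2 * `|qdot p q| <= qnormsq p + qnormsq q.
Proof.
rewrite !qnormsq_qdot -big_split /=.
apply: le_trans (_ : _ <= 2 * \sum_c `|p ord0 c * q ord0 c|) _.
  by rewrite ler_pM2l // ler_norm_sum.
rewrite mulr_sumr; apply: ler_sum => c _; set x := p _ _; set y := q _ _.
rewrite -[2 in leLHS]gtr0_norm // -normrM ler_norml.
have := sqr_ge0 (x + y); have := sqr_ge0 (x - y).
by move=> ? ?; apply/andP; split; nra.
Qed.

Lemma continuous_qnormsq : continuous (@qnormsq R).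
Proof.
have coordc (c : 'I_4) : continuous (fun q : quat R => q ord0 c).
  exact: (@coord_continuous R 1 4 ord0 c).
have sqc (c : 'I_4) : continuous (fun q : quat R => q ord0 c ^+ 2).
  by move=> q; exact: (continuousM (coordc c q) (coordc c q)).
rewrite (_ : @qnormsq R = fun q => \sum_c q ord0 c ^+ 2).
  by apply: (continuous_big add_continuous) => c _; exact: sqc.
apply/funext => q; rewrite qnormsq_qdot.
by apply: eq_bigr => c _; rewrite expr2.
Qed.

End SquaredNorm.

Section VectorNorm.
Context (R : realType) (n : nat).
Implicit Types (u : 'cV[quat R]_n) (M : 'M[quat R]_n).

Definition vnormsq u : R := \sum_i qnormsq (u i ord0).

Definition mnormsq M : R := \sum_i \sum_j qnormsq (M i j).

Lemma vnormsq_ge0 u : 0 <= vnormsq u.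
Proof. by apply: sumr_ge0 => i _; exact: qnormsq_ge0. Qed.

Lemma vnormsq_le0 u : vnormsq u <= 0 -> u = 0.
Proof.
move=> u0; have /eqP : vnormsq u = 0 by apply/eqP; rewrite eq_le u0 vnormsq_ge0.
rewrite psumr_eq0 => [/allP u00|i _]; last exact: qnormsq_ge0.
apply/matrixP => i j; rewrite ord1 mxE; apply/eqP.
by rewrite -qnormsq_eq0; have := u00 i; rewrite mem_index_enum => /(_ isT).
Qed.

Lemma vnormsq0 : vnormsq 0 = 0.
Proof.
by rewrite /vnormsq big1 // => i _; rewrite mxE; apply/eqP; rewrite qnormsq_eq0.
Qed.

(** The left side is the absolute rate of change of [vnormsq] along x' = M x.
    Inside the absolute value is a sum over i, j of terms 2 u_i . (M_ij u_j).
    By Young's inequality and |M_ij u_j| = |M_ij| |u_j|, each has absolute value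
    at most |u_i|^2 + |M_ij|^2 |u_j|^2.  The first summand is counted once for
    each j, which is where the factor n comes from. *)
Lemma qdot_mulmx_le M u :
  `|2 * \sum_i qdot (u i ord0) ((M *m u) i ord0)| <=
    (n%:R + mnormsq M) * vnormsq u.
Proof.
rewrite normrM gtr0_norm //.
apply: le_trans (_ : _ <= \sum_i \sum_j
    (qnormsq (u i ord0) + qnormsq (M i j) * vnormsq u)) _.
  apply: le_trans (ler_wpM2l _ (ler_norm_sum _ _ _)) _ => //.
  rewrite mulr_sumr; apply: ler_sum => i _.
  rewrite mxE qdot_sumr.
  apply: le_trans (ler_wpM2l _ (ler_norm_sum _ _ _)) _ => //.
  rewrite mulr_sumr; apply: ler_sum => j _.
  apply: le_trans (qdot_young _ _) _.
  rewrite lerD2l qnormsqM ler_wpM2l ?qnormsq_ge0 //.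
  rewrite /vnormsq (bigD1 j) //= lerDl.
  by apply: sumr_ge0 => k _; exact: qnormsq_ge0.
under eq_bigr do rewrite big_split sumr_const card_ord -mulr_suml.
by rewrite big_split -mulr_suml /= sumrMnl mulrDl mulr_natl.
Qed.

Lemma continuous_mnormsq (I : set R) (A : R -> 'M[quat R]_n) :
  {within I, continuous A} -> {within I, continuous (mnormsq \o A)}.
Proof.
(* Matrices carry the product topology: a neighbourhood of M i j pulls back to
   the neighbourhood of M that constrains the single entry (i, j). *)
have entryc i j : continuous (fun M => M i j).
  move=> M B /= MB.
  exists (fun k l => if (k == i) && (l == j) then B else setT).
    by move=> k l; case: ifP => [/andP[/eqP-> /eqP->]//|_]; exact: filterT.
  by move=> N /(_ i j); rewrite !eqxx.
have mnormsqc : continuous mnormsq.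
  apply: (continuous_big add_continuous) => i _.
  apply: (continuous_big add_continuous) => j _ M.
  apply: (continuous_comp (entryc i j M)).
  exact: continuous_qnormsq.
move=> Ac t; apply: (continuous_comp (Ac t)).
exact: mnormsqc.
Qed.

Lemma is_derive_vnormsq (x : R -> 'cV[quat R]_n) (t : R) (dx : 'cV[quat R]_n) :
  (forall i, is_derive t 1 (fun s => x s i ord0) (dx i ord0)) ->
  is_derive t 1 (fun s => vnormsq (x s))
    (2 * \sum_i qdot (x t i ord0) (dx i ord0)).
Proof.
move=> xD.
rewrite (_ : (fun s => _) = \sum_i (\sum_(c < 4)
    ((fun s => x s i ord0 ord0 c) * (fun s => x s i ord0 ord0 c)))); last first.
  apply/funext => s; rewrite fct_sumE; apply: eq_bigr => i _.
  by rewrite fct_sumE qnormsq_qdot.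
rewrite mulr_sumr; apply: is_derive_sum => i.
rewrite mulr_sumr; apply: is_derive_sum => c.
have {}xD := (is_derive_rowP _ _ _).1 (xD i) c.
by apply: is_derive_eq; rewrite /GRing.scale /= -mulr2n mulr_natl.
Qed.

End VectorNorm.

(** * Solutions of the right system *)

Section RightSolution.
Context (R : realType) (n : nat) (I : set R) (A : R -> 'M[quat R]_n).

Lemma right_solution_rscale x q : right_solution I A x ->
  right_solution I A (fun t => rscale (x t) q).
Proof.
move=> xsol t It i.
rewrite (_ : (fun s => _) = (fun p : quat R => p * q) \o (fun s => x s i ord0));
  last by apply/funext => s; rewrite /= mxE.
have -> : (A t *m rscale (x t) q) i ord0 = (A t *m x t) i ord0 * q.
  rewrite !mxE mulr_suml; apply: eq_bigr => j _.
  by rewrite mxE mulrA.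
exact: (is_derive_linear (mulq_linearl q) (xsol t It i)).
Qed.

Lemma right_solution_sum m (x : 'I_m -> R -> 'cV[quat R]_n) :
  (forall k, right_solution I A (x k)) ->
  right_solution I A (fun t => \sum_k x k t).
Proof.
move=> xsol t It i.
rewrite (_ : (fun s => _) = \sum_k (fun s => x k s i ord0)); last first.
  by apply/funext => s; rewrite fct_sumE summxE.
rewrite mulmx_sumr summxE; apply: is_derive_sum => k; exact: xsol.
Qed.

Lemma right_solutionB x y : right_solution I A x -> right_solution I A y ->
  right_solution I A (fun t => x t - y t).
Proof.
move=> xsol ysol t It i.
rewrite (_ : (fun s => _) = (fun s => x s i ord0) - (fun s => y s i ord0));
  last by apply/funext => s; rewrite !mxE.
have := is_deriveB (xsol t It i) (ysol t It i).
by rewrite mulmxBr [X in _ -> is_derive _ _ _ X]mxE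
  [X in _ -> is_derive _ _ _ (_ + X)]mxE.
Qed.

Lemma right_solution_rcomb m (x : 'I_m -> R -> 'cV[quat R]_n)
    (q : 'I_m -> quat R) : (forall k, right_solution I A (x k)) ->
  right_solution I A (fun t => \sum_k rscale (x k t) (q k)).
Proof.
by move=> xsol; apply: right_solution_sum => k; exact: right_solution_rscale.
Qed.

(** Uniqueness follows from [gronwall_zero] applied to [vnormsq] along x, on the
    segment joining t0 to t.  The interval hypothesis keeps that
    segment inside I, and its compactness bounds A there. *)
Lemma right_solution_eq0 x t0 :
  is_interval I -> {within I, continuous A} ->
  right_solution I A x -> I t0 -> x t0 = 0 -> forall t, I t -> x t = 0.
Proof.
move=> Iitv Ac xsol It0 x0 t It; apply: vnormsq_le0.
have grow a b : I a -> I b -> a <= b ->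
    (vnormsq (x a) = 0 -> vnormsq (x b) <= 0) /\
    (vnormsq (x b) = 0 -> vnormsq (x a) <= 0).
  move=> Ia Ib ab.
  have subI s : s \in `[a, b] -> I s.
    by rewrite in_itv /=; exact: Iitv.
  (* mnormsq (A c) bounds the coefficients of the system on [a, b]. *)
  have [c _ cmax] : exists2 c, c \in `[a, b] &
      forall s, s \in `[a, b] -> mnormsq (A s) <= mnormsq (A c).
    apply: EVT_max => //; apply: continuous_subspaceW (continuous_mnormsq Ac).
    exact: subI.
  apply: (@gronwall_zero _ (fun s => vnormsq (x s))
    (fun s => 2 * \sum_i qdot (x s i ord0) ((A s *m x s) i ord0))
    _ _ (n%:R + mnormsq (A c))) => // s sab.
    by apply: is_derive_vnormsq => i; apply: xsol; exact: subI.
  apply: le_trans (qdot_mulmx_le _ _) _.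
  by rewrite ler_wpM2r ?vnormsq_ge0 // lerD2l; exact: cmax.
have E0 : vnormsq (x t0) = 0 by rewrite x0 vnormsq0.
have [le|/ltW le] := leP t0 t.
  by have [/(_ E0)] := grow t0 t It0 It le.
by have [_ /(_ E0)] := grow t t0 It It0 le.
Qed.

End RightSolution.

Theorem theorem3p4 (R : realType) (n : nat) (I : set R)
  (A : R -> 'M[quat R]_n) (xs : 'I_n -> R -> 'cV[quat R]_n) :
  open I -> is_interval I ->
  {within I, continuous A} ->
  (forall k : 'I_n, right_solution I A (xs k)) ->
  right_independent I xs ->
  forall x : R -> 'cV[quat R]_n, right_solution I A x ->
  exists q : 'I_n -> quat R,
    forall t, I t -> x t = \sum_(k < n) rscale (xs k t) (q k).
Proof.
move=> _ Iitv Ac xs_sol xs_indep x x_sol.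
have [[t0 It0]|noI] := pselect (exists t0, I t0); last first.
  by exists (fun=> 0) => t It; case: noI; exists t.
(* A relation at t0 propagates to all of I by uniqueness. *)
have free0 q : \sum_(k < n) rscale (xs k t0) (q k) = 0 -> forall k, q k = 0.
  move=> q0 k; apply: contrapT => qk0; apply: xs_indep.
  exists q; split; first by exists k.
  by apply: (right_solution_eq0 Iitv Ac (right_solution_rcomb q xs_sol) It0).
have [q xq] := right_free_spans free0 (x t0).
exists q => t It; apply/subr0_eq.
apply: (right_solution_eq0 Iitv Ac
  (right_solutionB x_sol (right_solution_rcomb q xs_sol)) It0 _ It).
by rewrite -xq subrr.
Qed.
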